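(* Let $X$ be a reflexive smooth strictly convex Banach space over $\mathbb{C}$. Then $T\in B(X)$ is unitary if and only if $J^{-1}T'JT=TJ^{-1}T'J=I$.
   Context: $B(X)$ is the space of bounded linear operators on $X$, $I$ is the identity on $X$, $S_X=\{x\in X:\|x\|=1\}$, $X^*$ is the space of bounded linear functionals on $X$. $X$ is smooth if every $x\in S_X$ admits a unique $x^*\in S_{X^*}$ with $x^*(x)=1$. The duality mapping $J:X\to X^*$ of a smooth Banach space assigns to each $x$ the unique functional $J(x)$ with $\|J(x)\|=\|x\|$ and $J(x)(x)=\|x\|^2$; write $Jx=J(x)$. In general $J$ is not linear; it is surjective if and only if $X$ is reflexive and injective if and only if $X$ is strictly convex, so here $J$ is a bijection with inverse $J^{-1}:X^*\to X$. For $T\in B(X)$ the transpose $T':X^*\to X^*$ is $(T'f)(x)=f(Tx)$. Products denote compositions of maps. An operator $T\in B(X)$ on a smooth Banach space is called unitary if $\|Tx\|=\|T'Jx\|=\|x\|$ for all $x\in X$. *)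

(* Defs.v *)
(* The complex field is R[i] for R : realType,
   and C is made a normed space over itself as R[i]^o.  A norm over R[i] takes
   its values in the nonnegative reals of R[i]. *)
From HB Require Import structures.
From mathcomp Require Import all_boot all_order all_algebra complex.
From mathcomp Require Import all_classical all_reals all_analysis.

Set Implicit Arguments.
Unset Strict Implicit.
Unset Printing Implicit Defensive.

Import Order.TTheory GRing.Theory Num.Theory.
Import numFieldNormedType.Exports.

Local Open Scope classical_set_scope.
Local Open Scope ring_scope.
Local Open Scope complex_scope.

Section BoundedLinear.
Context {R : realType}.
Variables X Y : normedModType R[i].
Implicit Types (f g : X -> Y).

Definition bounded_linear_map f : Prop :=
  linear f /\ exists M : R[i], forall x, `|f x| <= M * `|x|.

Definition bounded_linear_pred : {pred X -> Y} :=
  fun f => `[< bounded_linear_map f >].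

Record bounded_linear : predArgType := BoundedLinear {
  bounded_linear_fun :> X -> Y;
  _ : bounded_linear_fun \in bounded_linear_pred }.

HB.instance Definition _ := [isSub for bounded_linear_fun].
HB.instance Definition _ := [Choice of bounded_linear by <:].

Lemma bounded_linearP (f : bounded_linear) : bounded_linear_map f.
Proof. by case: f => f /= /asboolP. Qed.

HB.instance Definition _ (f : bounded_linear) :=
  GRing.isLinear.Build R[i] X Y *:%R f (bounded_linearP f).1.

Lemma bounded_linear_submod : submod_closed bounded_linear_pred.
Proof.
split; first by apply/asboolP; split=> [a x y|];
  [rewrite scaler0 addr0 | exists 0 => x; rewrite mul0r normr0].
move=> a f g /asboolP[lf [M fM]] /asboolP[lg [N gN]]; apply/asboolP; split.
  move=> b x y; rewrite /= !fctE lf lg !scalerDr !scalerA (mulrC b a).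
  by rewrite addrACA.
exists (`|a| * M + N) => x; rewrite fctE mulrDl (le_trans (ler_normD _ _))//.
by rewrite lerD// normrZ -mulrA ler_wpM2l.
Qed.

HB.instance Definition _ := GRing.isSubmodClosed.Build R[i] (X -> Y)
  bounded_linear_pred bounded_linear_submod.
HB.instance Definition _ :=
  [SubChoice_isSubLmodule of bounded_linear by <:].

(* The operator norm, sup of `|f x| over the closed unit ball; the supremum is
   taken in R and injected into R[i]. *)
Definition op_norm (f : bounded_linear) : R[i] :=
  (sup [set complex.Re `|f x| | x in [set x : X | `|x| <= 1]])%:C.

Let normC (V : normedModType R[i]) (v : V) : (complex.Re `|v|)%:C = `|v|.
Proof. by rewrite RRe_real// ger0_real. Qed.

Lemma bounded_linear_bound (f : bounded_linear) :
  exists2 M : R[i], 0 <= M & forall x, `|f x| <= M * `|x|.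
Proof.
have [_ [M fM]] := bounded_linearP f; exists `|M| => // x.
have := fM x; rewrite -(ger0_norm (le_trans (normr_ge0 _) (fM x))).
by rewrite normrM normr_id.
Qed.

Let sup_op (f : bounded_linear) :
  has_sup [set complex.Re `|f x| | x in [set x : X | `|x| <= 1]].
Proof.
split; first by exists (complex.Re `|f 0|), 0 => //=; rewrite normr0 ler01.
have [M M0 fM] := bounded_linear_bound f.
exists (complex.Re M) => _ [x /= x1 <-].
rewrite -lecR normC RRe_real ?ger0_real// (le_trans (fM x))//.
by rewrite ler_piMr.
Qed.

Let op_norm_ub1 (f : bounded_linear) x : `|x| <= 1 -> `|f x| <= op_norm f.
Proof.
move=> x1; rewrite /op_norm -[leLHS]normC lecR.
by apply: sup_ubound; [case: (sup_op f)|exists x].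
Qed.

Lemma op_norm_ge0 (f : bounded_linear) : 0 <= op_norm f.
Proof. by rewrite (le_trans _ (@op_norm_ub1 f 0 _))// normr0. Qed.

Lemma op_norm_ub (f : bounded_linear) x : `|f x| <= op_norm f * `|x|.
Proof.
have [->|x0] := eqVneq x 0; first by rewrite linear0 !normr0 mulr0.
have nx : 0 < `|x| by rewrite normr_gt0.
rewrite -ler_pdivrMr//.
have := @op_norm_ub1 f (`|x|^-1 *: x).
rewrite linearZ !normrZ ger0_norm ?invr_ge0// mulVf ?gt_eqF// mulrC.
exact.
Qed.

Lemma op_norm_le (f : bounded_linear) (M : R[i]) :
  (forall x, `|x| <= 1 -> `|f x| <= M) -> op_norm f <= M.
Proof.
move=> fM; have M0 : 0 <= M by rewrite (le_trans _ (fM 0 _))// normr0.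
have MR : (complex.Re M)%:C = M by rewrite RRe_real// ger0_real.
rewrite -MR /op_norm lecR; apply: ge_sup; first by case: (sup_op f).
by move=> _ [x /= x1 <-]; rewrite -lecR MR normC; exact: fM.
Qed.

Let op_normD (f g : bounded_linear) : op_norm (f + g) <= op_norm f + op_norm g.
Proof.
apply: op_norm_le => x x1.
by rewrite (le_trans (ler_normD _ _))// lerD// op_norm_ub1.
Qed.

Let op_normZ (a : R[i]) (f : bounded_linear) :
  op_norm (a *: f) = `|a| * op_norm f.
Proof.
apply/eqP; rewrite eq_le; apply/andP; split.
  by apply: op_norm_le => x x1; rewrite normrZ ler_wpM2l// op_norm_ub1.
have [->|a0] := eqVneq a 0; first by rewrite normr0 mul0r op_norm_ge0.
rewrite -ler_pdivlMl ?normr_gt0//; apply: op_norm_le => x x1.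
by rewrite ler_pdivlMl ?normr_gt0// -normrZ (@op_norm_ub1 (a *: f)).
Qed.

Let op_norm_eq0 (f : bounded_linear) : op_norm f = 0 -> f = 0.
Proof.
move=> f0; apply/val_inj/funext => x /=; apply/normr0_eq0/eqP.
by rewrite eq_le normr_ge0 andbT (le_trans (op_norm_ub f x))// f0 mul0r.
Qed.

HB.instance Definition _ := Lmodule_isNormed.Build R[i] bounded_linear
  op_normD op_normZ op_norm_eq0.

Lemma bounded_linear_normE (f : bounded_linear) : `|f| = op_norm f.
Proof. by []. Qed.

End BoundedLinear.

Definition dual_space {R : realType} (X : normedModType R[i]) :
  normedModType R[i] := bounded_linear X R[i]^o.

Lemma transpose_subproof {R : realType} (X Y : normedModType R[i])
    (T : bounded_linear X Y) (f : dual_space Y) :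
  (fun x => f (T x)) \in @bounded_linear_pred R X R[i]^o.
Proof.
have [M M0 fM] := bounded_linear_bound f.
have [N N0 TN] := bounded_linear_bound T.
apply/asboolP; split; first by move=> a x y; rewrite !linearP.
exists (M * N) => x; rewrite (le_trans (fM _))// -mulrA.
by rewrite ler_wpM2l.
Qed.

Definition transpose {R : realType} (X Y : normedModType R[i])
    (T : bounded_linear X Y) : dual_space Y -> dual_space X :=
  fun f => BoundedLinear (transpose_subproof T f).

Section BanachGeometry.
Context {R : realType}.
Variable X : normedModType R[i].

Definition smooth : Prop :=
  forall x : X, `|x| = 1 -> exists! f : dual_space X, `|f| = 1 /\ f x = 1.

Definition strictly_convex : Prop :=
  forall (x y : X) (t : R), `|x| = 1 -> `|y| = 1 -> x <> y -> 0 < t < 1 ->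
    `|t%:C *: x + (1 - t)%:C *: y| < 1.

(* The canonical embedding of X into its bidual is onto. *)
Definition reflexive_space : Prop :=
  forall phi : dual_space (dual_space X),
    exists x : X, forall f : dual_space X, phi f = f x.

Definition is_dual_vector (x : X) (f : dual_space X) : Prop :=
  `|f| = `|x| /\ f x = `|x| ^+ 2.

(* Chosen among the functionals dual to x: on a smooth space there is exactly
   one (duality_map_unique), on other spaces the choice is arbitrary. *)
Definition duality_map (x : X) : dual_space X := xget 0 (is_dual_vector x).

(* A genuine two-sided inverse of duality_map as soon as the latter is
   bijective, which holds on reflexive smooth strictly convex Banach spaces. *)
Definition duality_map_inv : dual_space X -> X :=
  'pinv_(fun=> 0) [set: X] duality_map.

Lemma smooth_dual_vector : smooth ->
  forall x, exists! f : dual_space X, is_dual_vector x f.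
Proof.
move=> sX x; have [->|x0] := eqVneq x 0.
  exists 0; split=> [|f []]; last by rewrite normr0 => /normr0_eq0.
  by split; [rewrite !normr0 | rewrite normr0 expr0n].
have nx : `|x| != 0 by rewrite normr_eq0.
have nu : `| `|x|^-1 *: x| = 1.
  by rewrite normrZ normfV normr_id mulVf.
have [g [[g1 gx] gU]] := sX _ nu.
have gxE : g x = `|x|.
  by rewrite -[in LHS](scalerKV nx x) linearZ/= gx; exact: mulr1.
exists (`|x| *: g); split=> [|f [fn fx]].
  split; first by rewrite normrZ g1 normr_id mulr1.
  by rewrite -[LHS]/(`|x| * g x) gxE expr2.
rewrite (gU (`|x|^-1 *: f)) ?scalerKV//; split.
  by rewrite normrZ normfV normr_id fn mulVf.
rewrite linearZ/= -[LHS]/(`|x|^-1 * (`|x|^-1 * f x)) fx expr2.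
by rewrite mulKf// mulVf.
Qed.

Lemma duality_mapP : smooth -> forall x, is_dual_vector x (duality_map x).
Proof.
move=> sX x; have [f [fx _]] := smooth_dual_vector sX x.
exact: (xgetPex 0 (ex_intro _ f fx)).
Qed.

Lemma duality_map_unique : smooth ->
  forall x f, is_dual_vector x f -> f = duality_map x.
Proof.
move=> sX x f fx; have [g [_ gU]] := smooth_dual_vector sX x.
by rewrite -(gU _ fx); exact/gU/duality_mapP.
Qed.

Definition unitary_op (T : bounded_linear X X) : Prop :=
  forall x : X, `|T x| = `|x| /\ `|transpose T (duality_map x)| = `|x|.

End BanachGeometry.

(* Main.v *)
Require Import Defs.
From HB Require Import structures.
From mathcomp Require Import all_boot all_order all_algebra complex.
From mathcomp Require Import all_classical all_reals all_analysis.
From mathcomp Require Import ring lra.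
Set Implicit Arguments.
Unset Strict Implicit.
Unset Printing Implicit Defensive.

Import Order.TTheory GRing.Theory Num.Theory.
Import numFieldNormedType.Exports.
Local Open Scope classical_set_scope.
Local Open Scope ring_scope.
Local Open Scope complex_scope.

(** On a reflexive, smooth, strictly convex space the duality map [J] is a
    norm-preserving bijection, and [J x] is the only functional dual to [x];
    the equivalence is then a computation with that uniqueness.

    If [T] is unitary, [T' J (T x)] has norm [`|x|] and takes the value
    [`|T x| ^+ 2 = `|x| ^+ 2] at [x], so it is [J x]; this is the first
    identity.  For the second, put [y = J^-1 (T' (J x))]: then [`|y| = `|x|]
    and [J x (T y) = J y y = `|T y| ^+ 2], so that [J x] is dual to [T y],
    whence [T y = x].  Conversely the first identity says [T' J T = J], and
    evaluating both sides at [x] gives [`|T x| = `|x|]; this and the second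
    identity give [`|T' J x| = `|J^-1 T' J x| = `|T (J^-1 T' J x)| = `|x|].

    Injectivity of [J] is strict convexity ([duality_map_inj]).  Surjectivity
    ([reflexive_dual_vector]) says that every functional on a reflexive space
    attains its norm.  It needs a norming functional for [f] in the bidual,
    hence the Hahn-Banach theorem for complex normed spaces.

    Hahn-Banach is proved here without extending functionals from subspaces:
    among the sublinear functionals below a given one, a minimal one exists
    by Zorn's lemma, and minimality forces linearity.  The tool is the
    functional [slide p v], the infimum over [t >= 0] of
    [p (x + t *: v) - t * p v].  It is sublinear, lies below [p], and has
    value at most [- p v] at [- v].  Used on a minimal [p], it shows that [p]
    is odd; used on the functional one starts from, it prescribes the value
    at [v]. *)

(** * Sublinear functionals and the real Hahn-Banach theorem *)

Section SublinearFunctionals.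
Context {R : realType} {V : lmodType R}.
Implicit Types (p q f : V -> R) (x y v : V).

Definition sublinear p : Prop :=
  (forall x y, p (x + y) <= p x + p y) /\
  (forall a x, 0 < a -> p (a *: x) <= a * p x).

Lemma sublinear0 p : sublinear p -> p 0 = 0.
Proof.
move=> [pD pZ]; have := pD 0 0; have := pZ 2^-1 0.
by rewrite scaler0 addr0 invr_gt0 ltr0n => /(_ isT); lra.
Qed.

Lemma sublinearZ p a x : sublinear p -> 0 <= a -> p (a *: x) = a * p x.
Proof.
move=> sp; have [_ pZ] := sp.
rewrite le_eqVlt => /predU1P[<-|a0].
  by rewrite scale0r mul0r sublinear0.
apply/eqP; rewrite eq_le pZ//= -ler_pdivlMl//.
rewrite -[x in p x <= _](scalerK (lt0r_neq0 a0)).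
by rewrite pZ ?invr_gt0.
Qed.

Lemma sublinearN_le p x : sublinear p -> - p (- x) <= p x.
Proof.
move=> sp; have := sp.1 x (- x); rewrite subrr (sublinear0 sp); lra.
Qed.

(** Think of [E x] as the fibre over [x] of a convex cone in [V * R]: the lower
    boundary of a convex cone is sublinear.  Both infima below, along a chain
    and along a half-line, are instances. *)
Lemma inf_sublinear (E : V -> set R) (m : V -> R) :
  (forall x y r s, E x r -> E y s -> E (x + y) (r + s)) ->
  (forall a x r, 0 < a -> E x r -> E (a *: x) (a * r)) ->
  (forall x, E x !=set0) ->
  (forall x, lbound (E x) (m x)) ->
  sublinear (fun x => inf (E x)).
Proof.
move=> ED EZ E0 Em; have Eb x : has_lbound (E x) by exists (m x); exact: Em.
split=> [x y|a x a0].
  rewrite -lerBlDl; apply: lb_le_inf => // s Es.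
  rewrite lerBlDl -lerBlDr; apply: lb_le_inf => // r Er.
  by rewrite lerBlDr; apply: ge_inf => //; exact: ED.
rewrite -ler_pdivrMl//; apply: lb_le_inf => // r Er.
by rewrite ler_pdivrMl//; apply: ge_inf => //; exact: EZ.
Qed.

(** Closing the values [p (x + t *: v) - t * p v] upwards makes the set of
    pairs a convex cone, as [inf_sublinear] asks; the values by themselves are
    only subadditive, not additive, in [(x, t)]. *)
Definition slide_values p v x : set R :=
  [set r | exists2 t, 0 <= t & p (x + t *: v) <= r + t * p v].

Definition slide p v x : R := inf (slide_values p v x).

Lemma slide_values_lb p v x : sublinear p ->
  lbound (slide_values p v x) (- p (- x)).
Proof.
move=> sp r [t t0]; have := sp.1 (- x) (x + t *: v).
by rewrite addKr sublinearZ//; lra.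
Qed.

Lemma slide_le p v x r t : sublinear p -> 0 <= t ->
  p (x + t *: v) <= r + t * p v -> slide p v x <= r.
Proof.
move=> sp t0 ptr; apply: ge_inf; last by exists t.
by exists (- p (- x)); exact: slide_values_lb.
Qed.

Lemma slide_le_id p v x : sublinear p -> slide p v x <= p x.
Proof.
by move=> sp; apply: (slide_le sp (lexx 0)); rewrite scale0r mul0r !addr0.
Qed.

Lemma slideN p v : sublinear p -> slide p v (- v) <= - p v.
Proof.
move=> sp; apply: (slide_le sp ler01).
by rewrite scale1r !addNr sublinear0// mul1r addNr.
Qed.

Lemma slide_sublinear p v : sublinear p -> sublinear (slide p v).
Proof.
move=> sp; apply: (@inf_sublinear _ (fun x => - p (- x))).
- move=> x y r s [t t0 ptr] [u u0 pus]; exists (t + u); first exact: addr_ge0.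
  rewrite scalerDl addrACA mulrDl (le_trans (sp.1 _ _))//; lra.
- move=> a x r a0 [t t0 ptr]; exists (a * t); first by rewrite mulr_ge0// ltW.
  rewrite -scalerA -scalerDr (sublinearZ _ sp (ltW a0)) -mulrA -mulrDr.
  by rewrite ler_pM2l.
- by move=> x; exists (p x), 0 => //; rewrite scale0r mul0r !addr0.
- by move=> x; exact: slide_values_lb.
Qed.

(** Oddness turns subadditivity, applied to [(x + y) + (- y)], into the reverse
    inequality. *)
Lemma sublinear_odd_scalar p : sublinear p -> (forall x, p (- x) = - p x) ->
  scalar p.
Proof.
move=> sp pN.
have pD x y : p (x + y) = p x + p y.
  apply/eqP; rewrite eq_le sp.1/=.
  by have := sp.1 (x + y) (- y); rewrite addrK pN lerBrDr.
move=> a x y; rewrite pD; congr (_ + _).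
have [a0|/ltW a0] := leP 0 a; first exact: sublinearZ.
by rewrite -[a]opprK scaleNr pN sublinearZ ?oppr_ge0// !mulNr.
Qed.

(** Minimality forces [slide p x = p], and the value of [slide p x] at [- x]
    is at most [- p x]; a sublinear functional has no room below that. *)
Lemma minimal_sublinear_scalar p : sublinear p ->
  (forall q, sublinear q -> (forall x, q x <= p x) -> q = p) -> scalar p.
Proof.
move=> sp minp; apply: sublinear_odd_scalar => // x.
have slideE : slide p x = p.
  by apply: minp => [|y]; [exact: slide_sublinear|exact: slide_le_id].
have := slideN x sp; rewrite slideE => pNx.
by apply/le_anti; rewrite pNx lerNl sublinearN_le.
Qed.

(** In the Zorn order a chain is bounded by its pointwise infimum, which is
    finite because every [q] below [p] satisfies [- p (- x) <= q x]. *)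
Lemma exists_minimal_sublinear p : sublinear p ->
  exists q, [/\ sublinear q, forall x, q x <= p x &
    forall r, sublinear r -> (forall x, r x <= q x) -> r = q].
Proof.
move=> sp; pose S := {q | sublinear q /\ forall x, q x <= p x}.
pose le_rel (q r : S) := `[< forall x, sval r x <= sval q x >].
have [| | |A totA|[q [sq qp]] qmin] := @Zorn S le_rel.
- by move=> q; apply/asboolP.
- move=> q r s /asboolP qr /asboolP rs; apply/asboolP => x.
  exact: le_trans (rs x) (qr x).
- move=> [q Sq] [r Sr] /asboolP qr /asboolP rq; apply/eq_exist/funext => x.
  by apply/le_anti; rewrite qr rq.
- have [[q0 Aq0]|A0] := pselect (A !=set0); last first.
    exists (exist _ p (conj sp (fun=> lexx _))) => q Aq.
    by exfalso; apply: A0; exists q.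
  pose E x : set R := [set r | exists2 q : S, A q & sval q x <= r].
  have Em x : lbound (E x) (- p (- x)).
    move=> r [[q [sq qp]] _ /= qr].
    by rewrite (le_trans _ qr)// (le_trans _ (sublinearN_le _ sq))// lerN2.
  have sE : sublinear (fun x => inf (E x)).
    apply: (@inf_sublinear E (fun x => - p (- x))) => //.
    + move=> x y r s [q Aq qr] [q' Aq' qs].
      (* the smaller of the two functionals serves for both x and y *)
      have [/asboolP qq'|/asboolP qq'] := totA _ _ Aq Aq'.
        exists q' => //; rewrite (le_trans ((svalP q').1.1 _ _))// lerD//.
        exact: le_trans (qq' x) qr.
      exists q => //; rewrite (le_trans ((svalP q).1.1 _ _))// lerD//.
      exact: le_trans (qq' y) qs.
    + move=> a x r a0 [q Aq qr]; exists q => //.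
      by rewrite (le_trans ((svalP q).1.2 _ _ a0))// ler_pM2l.
    + by move=> x; exists (sval q0 x), q0.
  have infE (q : S) x : A q -> inf (E x) <= sval q x.
    move=> Aq; apply: ge_inf; last by exists q.
    by exists (- p (- x)); exact: Em.
  have Ep x : inf (E x) <= p x.
    by apply: le_trans (infE _ x Aq0) _; exact: (svalP q0).2.
  exists (exist _ (fun x => inf (E x)) (conj sE Ep)) => q Aq.
  by apply/asboolP => x; exact: infE.
- exists q; split=> // r sr rq.
  have rp x : r x <= p x by exact: le_trans (rq x) (qp x).
  have /qmin/(congr1 sval)// :
      le_rel (exist _ q (conj sq qp)) (exist _ r (conj sr rp)).
  exact/asboolP.
Qed.

(** A linear functional below [slide p v] is at most [- p v] at [- v], hence at
    least [p v] at [v]. *)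
Theorem hahn_banach_sublinear p v : sublinear p ->
  exists f, [/\ scalar f, forall x, f x <= p x & f v = p v].
Proof.
move=> sp; have [f [sf fle fmin]] :=
  exists_minimal_sublinear (slide_sublinear v sp).
have lf := minimal_sublinear_scalar sf fmin.
have fp x : f x <= p x by exact: le_trans (fle x) (slide_le_id _ _ sp).
exists f; split => //; apply/le_anti; rewrite fp/=.
rewrite -lerN2 (le_trans _ (slideN v sp))// (le_trans _ (fle _))//.
by have := sublinearN_le (- v) sf; rewrite opprK.
Qed.

End SublinearFunctionals.

(** * Norming functionals on complex normed spaces *)

(** An alias carrying the real structure, since the carrier itself already has
    a module structure over [R[i]]. *)
Definition realification (R : rcfType) (V : lmodType R[i]) : Type := V.

Section Realification.
Context {R : rcfType} (V : lmodType R[i]).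
Local Notation VR := (realification V).

HB.instance Definition _ := GRing.Zmodule.on VR.

Let scale_real (a : R) (x : VR) : VR := a%:C *: (x : V).

Let scale_realA a b x : scale_real a (scale_real b x) = scale_real (a * b) x.
Proof. by rewrite /scale_real scalerA rmorphM. Qed.

Let scale_real1 : left_id 1 scale_real.
Proof. by move=> x; rewrite /scale_real rmorph1 scale1r. Qed.

Let scale_realDr : right_distributive scale_real +%R.
Proof. by move=> a x y; rewrite /scale_real scalerDr. Qed.

Let scale_realDl x : {morph scale_real^~ x : a b / a + b}.
Proof. by move=> a b; rewrite /scale_real rmorphD scalerDl. Qed.

HB.instance Definition _ := GRing.Zmodule_isLmodule.Build R VR
  scale_realA scale_real1 scale_realDr scale_realDl.

Lemma realification_scaleE (a : R) (x : VR) : a *: x = a%:C *: (x : V) :> V.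
Proof. by []. Qed.

End Realification.

Section HahnBanach.
Context {R : realType} (V : normedModType R[i]).
Implicit Types (x v : V).

Definition normr_real x : R := complex.Re `|x|.

Lemma normr_realE x : (normr_real x)%:C = `|x|.
Proof. by rewrite RRe_real// ger0_real. Qed.

Lemma normr_real_sublinear : sublinear (normr_real : realification V -> R).
Proof.
split=> [x y|a x a0].
  by rewrite -lecR rmorphD/= !normr_realE ler_normD.
rewrite -lecR rmorphM/= !normr_realE realification_scaleE normrZ ger0_norm//.
by rewrite ler0c ltW.
Qed.

(** The unique complex-linear functional with real part [f], when [f] is
    real-linear. *)
Definition complexify (f : V -> R) x : R[i]^o := f x -i* f ('i%C *: x).

Lemma complexify_linear (f : realification V -> R) :
  scalar f -> linear (complexify f).
Proof.
move=> lf.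
have fD x y : f (x + y) = f x + f y by have := lf 1 x y; rewrite scale1r mul1r.
have f0 : f 0 = 0 by have := fD 0 0; rewrite addr0; lra.
have fZ (a : R) x : f (a%:C *: (x : V)) = a * f x.
  by have := lf a x 0; rewrite !addr0 f0 addr0.
have fii x : f ('i%C *: ('i%C *: (x : V))) = - f x.
  rewrite scalerA -expr2 sqr_i.
  by have := fZ (-1) x; rewrite rmorphN1 mulN1r.
move=> a x y; rewrite /complexify scalerDr !fD.
have -> : a *: x = (complex.Re a)%:C *: x + (complex.Im a)%:C *: ('i%C *: x).
  by rewrite scalerA -scalerDl mulrC -complexE.
rewrite scalerDr !fD !scalerA !(mulrC 'i%C) -!scalerA !fZ fii.
case: a => b c; apply/eqP; rewrite eq_complex /=.
by apply/andP; split; apply/eqP; ring.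
Qed.

(** Rotating [x] by a phase makes the value real, hence equal to [f] at the
    rotated vector, where the real bound applies. *)
Lemma complexify_norm (f : realification V -> R) :
  scalar f -> (forall x, f x <= normr_real x) ->
  forall x, `|complexify f x| <= `|x|.
Proof.
move=> lf fn x; have [->|z0] := eqVneq (complexify f x) 0.
  by rewrite normr0.
pose a : R[i] := `|complexify f x| / complexify f x.
have a1 : `|a| = 1 by rewrite normrM normr_id normfV divff// normr_eq0.
have ax : complexify f (a *: x) = `|complexify f x|.
  rewrite (scalable_linear (complexify_linear lf)).
  by rewrite -[LHS]/(a * complexify f x) divfK.
have ax_real : complexify f (a *: x) = (f (a *: x))%:C.
  have := ger0_Im (normr_ge0 (complexify f x)).
  by rewrite -ax /complexify /= => ->.
by rewrite -ax ax_real -[`|x|]mul1r -a1 -normrZ -normr_realE lecR.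
Qed.

Lemma hahn_banach_norming v : exists2 phi : dual_space V,
  `|phi| <= 1 & phi v = `|v|.
Proof.
have [f [lf fn fv]] :=
  hahn_banach_sublinear (v : realification V) normr_real_sublinear.
have phin := complexify_norm lf fn.
have phiP : complexify f \in @bounded_linear_pred R V R[i]^o.
  apply/asboolP; split; first exact: complexify_linear.
  by exists 1 => x; rewrite mul1r.
exists (BoundedLinear phiP).
  by apply: op_norm_le => x x1; apply: le_trans (phin x) x1.
(* the real part of the value at v already exhausts the bound on its modulus *)
have im0 : f ('i%C *: v) = 0.
  have : `|complexify f v| ^+ 2 <= `|v| ^+ 2 by rewrite lerXn2r// nnegrE.
  rewrite -add_Re2_Im2 -normr_realE -fv -rmorphXn lecR /= sqrrN gerDl => i2.
  by apply/eqP; rewrite -sqrf_eq0 eq_le i2 sqr_ge0.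
rewrite /= /complexify im0 oppr0 fv; exact: normr_realE.
Qed.

End HahnBanach.

(** * Bijectivity of the duality map *)

Section DualityMap.
Context {R : realType} {X : normedModType R[i]}.
Implicit Types (x y : X) (f g : dual_space X).

Lemma dual_le f x : `|f x| <= `|f| * `|x|.
Proof. exact: op_norm_ub. Qed.

(** Reflexivity represents a norming functional of [f] by a point [x] with
    [f x = `|f|]; smoothness bounds [`|x|] by testing against [J x].  The
    multiple [`|f| *: x] is the vector sought, which covers [f = 0] too. *)
Lemma reflexive_dual_vector : reflexive_space X -> smooth X ->
  forall f, exists x, is_dual_vector x f.
Proof.
move=> reflX smoothX f.
have [Phi Phi1 Phif] := hahn_banach_norming f; have [x PhiE] := reflX Phi.
have [Jx Jxx] := duality_mapP smoothX x.
have x1 : `|x| <= 1.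
  have [->|x0] := eqVneq x 0; first by rewrite normr0.
  have nx : 0 < `|x| by rewrite normr_gt0.
  rewrite -(ler_pM2r nx) -expr2 -Jxx -PhiE mul1r -Jx.
  have Phi_x := op_norm_ub Phi (duality_map x).
  have Phi_real : Phi (duality_map x) = `|Phi (duality_map x)|.
    by rewrite PhiE Jxx ger0_norm// exprn_ge0.
  by rewrite Phi_real (le_trans Phi_x)// ler_piMl.
have fx : f x = `|f| by rewrite -PhiE.
have nfx : `| `|f| *: x| = `|f|.
  apply/le_anti; rewrite normrZ normr_id ler_piMr//=.
  by have := dual_le f x; rewrite fx normr_id.
by exists (`|f| *: x); split; rewrite nfx// linearZ/= fx expr2.
Qed.

(** Vectors with a common dual functional have the same norm, and the functional
    shows that their midpoint has that norm as well. *)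
Lemma duality_map_inj : smooth X -> strictly_convex X ->
  injective (@duality_map R X).
Proof.
move=> smoothX convX x y Jxy.
have [Jx Jxx] := duality_mapP smoothX x.
have [Jy Jyy] := duality_mapP smoothX y.
have nxy : `|x| = `|y| by rewrite -Jx -Jy Jxy.
have [y0|y0] := eqVneq y 0.
  by rewrite y0; apply: normr0_eq0; rewrite nxy y0 normr0.
have ny : 0 < `|y| by rewrite normr_gt0.
apply: contrapT => neq_xy.
have := convX (`|y|^-1 *: x) (`|y|^-1 *: y) 2^-1.
rewrite !normrZ normfV normr_id nxy mulVf ?gt_eqF// => /(_ erefl erefl).
have neq_xy' : `|y|^-1 *: x <> `|y|^-1 *: y.
  by move=> /(scalerI _) xy; apply/neq_xy/xy; rewrite invr_eq0 gt_eqF.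
have half : 0 < (2^-1 : R) < 1 by lra.
move=> /(_ neq_xy' half).
have -> : 1 - 2^-1 = 2^-1 :> R by lra.
rewrite -!scalerDr scalerA normrZ.
have sum_norm : 2 * `|y| <= `|x + y|.
  rewrite -(ler_pM2l ny) -[in leRHS]Jy (le_trans _ (dual_le _ _))//.
  rewrite linearD/= -[in X in X + _]Jxy Jxx Jyy nxy ger0_norm.
    by rewrite mulrCA -expr2 mulr_natl mulr2n.
  by rewrite addr_ge0// exprn_ge0.
have -> : `|(2^-1)%:C / `|y| : R[i]| = (2 * `|y|)^-1.
  rewrite fmorphV rmorph_nat -invfM ger0_norm// invr_ge0 mulr_ge0.
by rewrite mulrC ltr_pdivrMr ?mulr_gt0// mul1r le_gtF.
Qed.

Lemma duality_mapK : smooth X -> strictly_convex X ->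
  cancel (@duality_map R X) (@duality_map_inv R X).
Proof.
move=> smoothX convX x; apply: pinvKV; rewrite ?inE//.
by move=> y z _ _; exact: duality_map_inj.
Qed.

Lemma duality_map_invK : reflexive_space X -> smooth X ->
  cancel (@duality_map_inv R X) (@duality_map R X).
Proof.
move=> reflX smoothX f; apply: pinvK; rewrite inE.
have [x xf] := reflexive_dual_vector reflX smoothX f.
by exists x => //; rewrite (duality_map_unique smoothX xf).
Qed.

Lemma norm_duality_map x : smooth X -> `|duality_map x| = `|x|.
Proof. by move=> smoothX; have [] := duality_mapP smoothX x. Qed.

Lemma norm_duality_map_inv f : reflexive_space X -> smooth X ->
  `|duality_map_inv f| = `|f|.
Proof.
by move=> rX sX; rewrite -[in RHS](duality_map_invK rX sX f) norm_duality_map.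
Qed.

End DualityMap.

(** * Unitary operators *)

Local Close Scope classical_set_scope.

Theorem theorem12 (R : realType) (X : completeNormedModType R[i])
    (reflX : reflexive_space X) (smoothX : smooth X)
    (convX : strictly_convex X) (T : bounded_linear X X) :
  let J : X -> dual_space X := duality_map (X := X) in
  let Jinv : dual_space X -> X := duality_map_inv (X := X) in
  unitary_op T <->
  (Jinv \o transpose T \o J \o T = id /\ T \o Jinv \o transpose T \o J = id).
Proof.
move=> J Jinv.
have JK : cancel J Jinv by exact: duality_mapK.
have JinvK : cancel Jinv J by exact: duality_map_invK.
have JP x : is_dual_vector x (J x) by exact: duality_mapP.
have Junique x f : is_dual_vector x f -> f = J x by exact: duality_map_unique.
split=> [unitT|[left_inv right_inv]].
  split; apply/funext => x /=.
    suff -> : transpose T (J (T x)) = J x by [].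
    apply: Junique; split; first by rewrite (unitT _).2 (unitT _).1.
    by rewrite /= (JP _).2 (unitT _).1.
  apply: (can_inj JK); apply/esym/Junique.
  have ny : `|Jinv (transpose T (J x))| = `|x|.
    by rewrite norm_duality_map_inv// (unitT _).2.
  split; first by rewrite (unitT _).1 ny (JP x).1.
  by rewrite (unitT _).1 -(JP _).2 JinvK.
have JT x : transpose T (J (T x)) = J x.
  by rewrite -[LHS]JinvK; congr J; exact: (congr1 (@^~ x) left_inv).
have normT x : `|T x| = `|x|.
  by apply/eqP; rewrite -(eqrXn2 (n := 2))// -(JP x).2 -JT /= (JP _).2.
move=> x; split=> //; rewrite -/(J x) -norm_duality_map_inv// -/Jinv -normT.
by congr (`|_|); exact: (congr1 (@^~ x) right_inv).
Qed.
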